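(* Let $\Phi$ be a signature. Every extended $\Phi$-program $E(\vec{x})$ is reducible to a unique up to congruence irreducible extended program $\mathrm{cf}(E(\vec x))$ (its canonical form). In detail: with every extended $\Phi$-program $E(\vec{x})$ we can associate an extended $\Phi$-program $\mathrm{cf}(E(\vec x))$ (with the same list $\vec x$) such that: (1) $\mathrm{cf}(E(\vec x))$ is irreducible; (2) $E(\vec x)\Rightarrow \mathrm{cf}(E(\vec x))$; (3) if $F(\vec x)$ is irreducible and $E(\vec x)\Rightarrow F(\vec x)$, then $F(\vec x)\equiv_c \mathrm{cf}(E(\vec x))$. It follows that for all extended programs $E(\vec x),F(\vec x)$: if $E(\vec x)\Rightarrow F(\vec x)$, then $\mathrm{cf}(E(\vec x))\equiv_c \mathrm{cf}(F(\vec x))$.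
   Context: **Terms.** A signature $\Phi$ is a set of function symbols $\phi$, each with $\mathrm{arity}(\phi)\in\mathbb N$ and $\mathrm{sort}(\phi)\in\{\mathsf{ind},\mathsf{boole}\}$. There are individual variables $v_0,v_1,\dots$ (of sort $\mathsf{ind}$) and, for each sort $s$ and $n\in\mathbb N$, infinitely many function variables $p^{s,n}_i$ of sort $s$ and arity $n$. Terms are: $\mathrm{tt},\mathrm{ff}$ (sort $\mathsf{boole}$); individual variables; $p(F_1,\dots,F_n)$ for $p$ a function variable of arity $n$, and $\phi(F_1,\dots,F_n)$ for $\phi\in\Phi$ of arity $n$, where the $F_i$ are terms of sort $\mathsf{ind}$ (the sort of the term is that of $p$, resp. $\phi$); and conditionals ''if $F_0$ then $F_1$ else $F_2$'', also written $\mathrm{cond}(F_0,F_1,F_2)$, with $F_0$ of sort $\mathsf{boole}$ and $F_1,F_2$ of the same sort (which is the sort of the conditional). Write $\mathsf c(F_1,\dots,F_l)$ for a term whose outermost operation $\mathsf c$ is a symbol of $\Phi$, a function variable or $\mathrm{cond}$ (with $l=3$). $\equiv$ is syntactic identity. **Programs.** A $\Phi$-program is an expression $E\equiv E_0 \text{ where } \{p_1(\vec x_1)=E_1,\dots,p_K(\vec x_K)=E_K\}$, $K\ge 0$, where $p_1,\dots,p_K$ are distinct function variables, each $E_i$ is a term whose function variables are among $p_1,\dots,p_K$, and for $1\le i\le K$, $\vec x_i$ is a list of $\mathrm{arity}(p_i)$ distinct individual variables including all those which occur in $E_i$, and $\mathrm{sort}(E_i)=\mathrm{sort}(p_i)$.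 $E_0$ is the head, the set of equations is the body, and $E_0,\dots,E_K$ are the parts. An extended program $E(\vec x)$ is a pair of a program $E$ and a list $\vec x=(x_1,\dots,x_n)$ of distinct individual variables which includes all those occurring in $E_0$. Put $\mathrm{set}(E(\vec x))=\{E_0(\vec x),\ p_1(\vec x_1)=E_1,\dots,p_K(\vec x_K)=E_K\}$. **Congruence.** $E\equiv_c F$ if $F$ can be obtained from $E$ by an alphabetic change (renaming) of the bound function variables $p_1,\dots,p_K$ (to distinct ones of the same sorts and arities) and of the bound individual variables $\vec x_i$ in the equations of the body, and a permutation of the equations in the body. $E(\vec x)\equiv_c F(\vec y)$ means $\vec x\equiv\vec y$ and $E\equiv_c F$. **Immediate, irreducible.** A term is immediate if it is an individual variable, a nullary function variable, or $p(u_1,\dots,u_n)$ with $p$ a function variable and $u_1,\dots,u_n$ individual variables. A term is irreducible if it is immediate, or $\mathrm{tt}$, or $\mathrm{ff}$, or $\mathsf c(I_1,\dots,I_l)$ with $I_1,\dots,I_l$ immediate. An extended program is irreducible if all its parts are irreducible terms. **Reduction.** A function variable is fresh (for $E$) if it is none of $p_1,\dots,p_K$. The relation $E(\vec x)\xrightarrow{(p,j,q)}F(\vec x)$, with $p,q$ function variables and $j$ a number, holds in two cases. Body case: the equation $p(\vec x_p)=\mathsf c(G_1,\dots,G_l)$ is in the body of $E$, $1\le j\le l$, $G_j$ is not immediate, $q$ is fresh, $\mathrm{arity}(q)=\mathrm{arity}(p)$, $\mathrm{sort}(q)=\mathrm{sort}(G_j)$, and $\mathrm{set}(F(\vec x))$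 is obtained from $\mathrm{set}(E(\vec x))$ by replacing this equation by the two equations $p(\vec x_p)=\mathsf c(G_1,\dots,G_{j-1},q(\vec x_p),G_{j+1},\dots,G_l)$ and $q(\vec x_p)=G_j$. Head case: $p,q$ are both fresh, $E_0\equiv\mathsf c(G_1,\dots,G_l)$, $1\le j\le l$, $G_j$ is not immediate, $\mathrm{arity}(q)=n$ (the length of $\vec x$), $\mathrm{sort}(q)=\mathrm{sort}(G_j)$, and $\mathrm{set}(F(\vec x))$ is obtained from $\mathrm{set}(E(\vec x))$ by replacing the head by $\mathsf c(G_1,\dots,G_{j-1},q(\vec x),G_{j+1},\dots,G_l)$ and adding the equation $q(\vec x)=G_j$. One-step reduction: $E(\vec x)\Rightarrow_1F(\vec x)$ iff $E(\vec x)\xrightarrow{(p,j,q)}F(\vec x)$ for some $p,j,q$. Full reduction: $E(\vec x)\Rightarrow F(\vec x)$ iff $E\equiv_cF$, or there are $F^1,\dots,F^k$ with $E(\vec x)\Rightarrow_1F^1(\vec x)\Rightarrow_1\cdots\Rightarrow_1F^k(\vec x)$ and $F^k\equiv_cF$. *)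

(* Defs.v *)
From Stdlib Require Import Permutation Relation_Operators.
From HB Require Import structures.
From mathcomp Require Import all_boot.
From mathcomp Require Import classical_sets.

Set Implicit Arguments.
Unset Strict Implicit.
Unset Printing Implicit Defensive.

Inductive vsort := Ind | Boole.

Definition bool_of_vsort (s : vsort) := if s is Ind then true else false.
Definition vsort_of_bool (b : bool) := if b then Ind else Boole.
Lemma bool_of_vsortK : cancel bool_of_vsort vsort_of_bool.
Proof. by case. Qed.
HB.instance Definition _ := Equality.copy vsort (can_type bool_of_vsortK).

Record signature := Signature {
  symbol :> Type;
  sym_arity : symbol -> nat;
  sym_sort : symbol -> vsort
}.

Notation ivar := nat (only parsing).

Record fvar := Fvar { fv_sort : vsort; fv_arity : nat; fv_index : nat }.

Definition code_of_fvar (p : fvar) := (fv_sort p, fv_arity p, fv_index p).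
Definition fvar_of_code (c : vsort * nat * nat) := Fvar c.1.1 c.1.2 c.2.
Lemma code_of_fvarK : cancel code_of_fvar fvar_of_code.
Proof. by case. Qed.
HB.instance Definition _ := Equality.copy fvar (can_type code_of_fvarK).

Section Terms.
Variable Phi : signature.

Inductive op := Osym of Phi | Ofun of fvar | Ocond.

(* Raw terms: [App c [:: F_1; ..; F_l]] is c(F_1,...,F_l); arities and sorts
   are imposed by [wf_term] below. *)
Inductive term := TT | FF | Var of ivar | App of op & seq term.

(* The value on a conditional without exactly three arguments is junk: such
   terms are not well formed. *)
Fixpoint term_sort (t : term) : vsort :=
  match t with
  | TT | FF => Boole
  | Var _ => Ind
  | App (Osym f) _ => sym_sort f
  | App (Ofun p) _ => fv_sort p
  | App Ocond args => if args is [:: _; t1; _] then term_sort t1 else Boole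
  end.

Fixpoint wf_term (t : term) : bool :=
  match t with
  | App c args => all wf_term args &&
    match c with
    | Osym f =>
        (size args == sym_arity f) && all (fun a => term_sort a == Ind) args
    | Ofun p =>
        (size args == fv_arity p) && all (fun a => term_sort a == Ind) args
    | Ocond => if args is [:: t0; t1; t2]
               then (term_sort t0 == Boole) && (term_sort t1 == term_sort t2)
               else false
    end
  | _ => true
  end.

Fixpoint ivars (t : term) : seq ivar :=
  match t with
  | Var i => [:: i]
  | App _ args => flatten (map ivars args)
  | _ => [::]
  end.

Fixpoint fvars (t : term) : seq fvar :=
  match t with
  | App c args =>
      (if c is Ofun p then [:: p] else [::]) ++ flatten (map fvars args)
  | _ => [::]
  end.

Definition call (q : fvar) (xs : seq ivar) : term := App (Ofun q) (map Var xs).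

Definition is_ivar (t : term) : bool := if t is Var _ then true else false.

(* A nullary function variable is [App (Ofun p) [::]]. *)
Definition immediate (t : term) : bool :=
  match t with
  | Var _ => true
  | App (Ofun _) args => all is_ivar args
  | _ => false
  end.

Definition irreducible_term (t : term) : bool :=
  immediate t ||
  match t with
  | TT | FF => true
  | App _ args => all immediate args
  | Var _ => false
  end.

Record equation :=
  Eqn { eqn_fun : fvar; eqn_vars : seq ivar; eqn_rhs : term }.

Definition wf_equation (ps : seq fvar) (e : equation) : bool :=
  [&& size (eqn_vars e) == fv_arity (eqn_fun e),
      uniq (eqn_vars e),
      all (mem (eqn_vars e)) (ivars (eqn_rhs e)),
      wf_term (eqn_rhs e),
      term_sort (eqn_rhs e) == fv_sort (eqn_fun e)
    & all (mem ps) (fvars (eqn_rhs e))].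

Definition wf_program (t0 : term) (b : seq equation) : bool :=
  let ps := map eqn_fun b in
  [&& uniq ps, wf_term t0, all (mem ps) (fvars t0) & all (wf_equation ps) b].

Record program := Program {
  prog_head : term;
  prog_body : seq equation;
  prog_wf : wf_program prog_head prog_body
}.

Definition bound_fvars (E : program) : seq fvar := map eqn_fun (prog_body E).

Record xprogram := XProgram {
  xprog :> program;
  xvars : seq ivar;
  xprog_wf : uniq xvars && all (mem xvars) (ivars (prog_head xprog))
}.

Inductive part := HeadPart of term & seq ivar | BodyPart of equation.

Definition xset (E : xprogram) : set part :=
  (fun i => match i with
            | HeadPart t xs => t = prog_head E /\ xs = xvars E
            | BodyPart e => List.In e (prog_body E)
            end).

Definition irreducible (E : program) : bool :=
  irreducible_term (prog_head E) &&
  all (fun e => irreducible_term (eqn_rhs e)) (prog_body E).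

Fixpoint rename (rho : fvar -> fvar) (sigma : ivar -> ivar) (t : term) : term :=
  match t with
  | Var i => Var (sigma i)
  | App c args =>
      App (if c is Ofun p then Ofun (rho p) else c)
          (map (rename rho sigma) args)
  | _ => t
  end.

Definition rename_equation (rho : fvar -> fvar) (sigma : ivar -> ivar)
    (e : equation) : equation :=
  Eqn (rho (eqn_fun e)) (map sigma (eqn_vars e))
      (rename rho sigma (eqn_rhs e)).

(* Individual variables are bound separately in each equation of the body, so
   each equation has its own renaming of them; those of the head are free and
   are kept. *)
Definition alpha_equation (rho : fvar -> fvar) (e e' : equation) : Prop :=
  exists2 sigma : ivar -> ivar,
    {in eqn_vars e &, injective sigma} & e' = rename_equation rho sigma e.

Definition congruent (E F : program) : Prop :=
  exists (rho : fvar -> fvar) (b : seq equation),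
    [/\ {in bound_fvars E &, injective rho},
        {in bound_fvars E, forall p,
           fv_sort (rho p) = fv_sort p /\ fv_arity (rho p) = fv_arity p},
        prog_head F = rename rho id (prog_head E),
        List.Forall2 (alpha_equation rho) (prog_body E) b
      & Permutation b (prog_body F)].

Definition xcongruent (E F : xprogram) : Prop :=
  xvars E = xvars F /\ congruent E F.

Definition fresh (E : program) (q : fvar) : bool := q \notin bound_fvars E.

Local Open Scope classical_set_scope.

(* The G_1,...,G_l of the definition are [l ++ g :: r] with g = G_j; positions
   are numbered from 1. *)
Inductive step (E : xprogram) (p : fvar) (j : nat) (q : fvar) (F : xprogram) :
    Prop :=
| step_body (xs : seq ivar) (c : op) (l : seq term) (g : term) (r : seq term) of
    List.In (Eqn p xs (App c (l ++ g :: r))) (prog_body E)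
  & j = (size l).+1
  & ~~ immediate g
  & fresh E q
  & fv_arity q = fv_arity p
  & fv_sort q = term_sort g
  & xset F = (xset E `\ BodyPart (Eqn p xs (App c (l ++ g :: r)))) `|`
             [set BodyPart (Eqn p xs (App c (l ++ call q xs :: r)));
                  BodyPart (Eqn q xs g)]
| step_head (c : op) (l : seq term) (g : term) (r : seq term) of
    fresh E p
  & fresh E q
  & prog_head E = App c (l ++ g :: r)
  & j = (size l).+1
  & ~~ immediate g
  & fv_arity q = size (xvars E)
  & fv_sort q = term_sort g
  & xset F = (xset E `\ HeadPart (App c (l ++ g :: r)) (xvars E)) `|`
             [set HeadPart (App c (l ++ call q (xvars E) :: r)) (xvars E);
                  BodyPart (Eqn q (xvars E) g)].

Definition red1 (E F : xprogram) : Prop := exists p j q, step E p j q F.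

Definition reduces (E F : xprogram) : Prop :=
  xcongruent E F \/
  exists2 G : xprogram, clos_trans xprogram red1 E G & xcongruent G F.

End Terms.

(* Main.v *)
(** A position of [E] is a part together with a path to one of its subterms that
    runs through nonimmediate arguments only.  Reduction merely gives such
    subterms parts of their own, so an irreducible program reached from [E] has
    exactly one part for each position of [E] and is determined by the injective
    choice of their names.  This relation, [flattening E F], holds between an
    irreducible program and itself, and it is inherited backwards along one-step
    reductions and congruences: when the [i]-th argument in a part [k] becomes a
    new part [q], the position [i :: pi] of [k] becomes the position [pi] of [q].
    Two flattenings of [E] are congruent by matching names.  Existence holds
    since each reduction consumes one position with a nonempty path. *)

Require Import Defs.
From Stdlib Require Import Permutation Relation_Operators.
From mathcomp Require Import all_boot.
From mathcomp Require Import boolp classical_sets.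
From mathcomp Require Import zify.

Set Implicit Arguments.
Unset Strict Implicit.
Unset Printing Implicit Defensive.

(** * Lists without decidable equality, and fresh function variables *)

Lemma all_In (T : Type) (P : pred T) (s : seq T) :
  reflect (forall x, List.In x s -> P x) (all P s).
Proof.
elim: s => [|a s IH] /=; first by left.
apply: (iffP andP) => [[Pa /IH Ps] x [<- //|]|Ps]; first exact: Ps.
by split; [apply: Ps; left|apply/IH => x xs; apply: Ps; right].
Qed.

Lemma In_nth (T : Type) (x0 : T) (s : seq T) (i : nat) :
  i < size s -> List.In (nth x0 s i) s.
Proof. by elim: s i => [|a s IH] [|i] //= lti; [left|right; apply: IH]. Qed.

Lemma In_map_mem (T : Type) (S : eqType) (f : T -> S) (s : seq T) (x : T) :
  List.In x s -> f x \in map f s.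
Proof.
elim: s => [|a s IH] //= [->|/IH xs]; first exact: mem_head.
by rewrite inE xs orbT.
Qed.

Lemma mem_map_In (T : Type) (S : eqType) (f : T -> S) (s : seq T) (y : S) :
  y \in map f s -> exists2 x, List.In x s & f x = y.
Proof.
elim: s => [|a s IH] //=; rewrite inE => /predU1P[->|/IH[x xs <-]].
  by exists a => //; left.
by exists x => //; right.
Qed.

Lemma uniq_map_In_inj (T : Type) (S : eqType) (f : T -> S) (s : seq T) (x y : T) :
  uniq (map f s) -> List.In x s -> List.In y s -> f x = f y -> x = y.
Proof.
elim: s => [|a s IH] //= /andP[nas us] [<-|xs] [<-|ys] // fxy.
- by case/negP: nas; rewrite fxy; exact: In_map_mem.
- by case/negP: nas; rewrite -fxy; exact: In_map_mem.
exact: IH.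
Qed.

Lemma uniq_map_NoDup (T : Type) (S : eqType) (f : T -> S) (s : seq T) :
  uniq (map f s) -> List.NoDup s.
Proof.
elim: s => [|a s IH] /=; first by constructor.
by case/andP=> nas /IH ?; constructor => // /(In_map_mem f); apply/negP.
Qed.

Lemma nth_change (T : Type) (x0 : T) (l r : seq T) (g h : T) (i : nat) :
  i != size l -> nth x0 (l ++ g :: r) i = nth x0 (l ++ h :: r) i.
Proof.
move=> nil; rewrite !nth_cat; case: ltngtP nil => // lt _.
by rewrite -[i - size l](@prednK) ?subn_gt0.
Qed.

Lemma nth_middle (T : Type) (x0 : T) (l r : seq T) (g : T) :
  nth x0 (l ++ g :: r) (size l) = g.
Proof. by rewrite nth_cat ltnn subnn. Qed.

Definition fresh_fvar (ps : seq fvar) (s : vsort) (n : nat) : fvar :=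
  Fvar s n (\max_(p <- ps) fv_index p).+1.

Lemma fresh_fvarP (ps : seq fvar) (s : vsort) (n : nat) :
  fresh_fvar ps s n \notin ps.
Proof.
apply/negP => qs; have := @leq_bigmax_seq _ ps xpredT fv_index _ qs erefl.
by rewrite /= ltnn.
Qed.

(** * Induction on terms and renaming *)

(** Arguments sit inside a list, so the induction hypothesis is indexed by argument number, in the
    form in which [subterm] reads arguments. *)
Lemma term_nth_ind (Phi : signature) (P : term Phi -> Prop) :
  P (TT Phi) -> P (FF Phi) -> (forall i, P (Var Phi i)) ->
  (forall c args,
     (forall i, i < size args -> P (nth (TT Phi) args i)) -> P (App c args)) ->
  forall t, P t.
Proof.
move=> PT PF PV PA; fix IH 1 => -[||i|c args];
  [exact: PT|exact: PF|exact: PV|apply: PA].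
elim: args => [|a args IHa] [|i] lti; [by []|by []|exact: IH|exact: IHa].
Qed.

Lemma mem_ivars_nth (Phi : signature) (c : op Phi) args i x :
  i < size args -> x \in ivars (nth (TT Phi) args i) -> x \in ivars (App c args).
Proof.
move=> lti xi; apply/flattenP; exists (ivars (nth (TT Phi) args i)) => //.
by rewrite -(nth_map _ [::]) // mem_nth ?size_map.
Qed.

Lemma mem_fvars_nth (Phi : signature) (c : op Phi) args i x :
  i < size args -> x \in fvars (nth (TT Phi) args i) -> x \in fvars (App c args).
Proof.
move=> lti xi; rewrite mem_cat; apply/orP; right; apply/flattenP.
exists (fvars (nth (TT Phi) args i)) => //.
by rewrite -(nth_map _ [::]) // mem_nth ?size_map.
Qed.

(** Agreement is asked only on occurring variables, because later renamings are controlled only on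
    bound names and on the parameters of one part. *)
Lemma rename_comp (Phi : signature) (rho1 rho2 rho : fvar -> fvar)
    (sigma1 sigma2 sigma : nat -> nat) (t : term Phi) :
  {in fvars t, forall p, rho2 (rho1 p) = rho p} ->
  {in ivars t, forall x, sigma2 (sigma1 x) = sigma x} ->
  rename rho2 sigma2 (rename rho1 sigma1 t) = rename rho sigma t.
Proof.
elim/term_nth_ind: t => [||i|c args IH] //= Hrho Hsigma.
  by rewrite Hsigma ?mem_head.
congr App; first by case: c Hrho => //= p -> //; rewrite mem_head.
apply: (@eq_from_nth _ (TT Phi)); rewrite ?size_map // => i lti.
rewrite !(nth_map (TT Phi)) ?size_map //; apply: IH => // x xi.
  exact/Hrho/(@mem_fvars_nth _ c _ i).
exact/Hsigma/(@mem_ivars_nth _ c _ i).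
Qed.

Lemma rename_id (Phi : signature) (t : term Phi) : rename id id t = t.
Proof.
elim/term_nth_ind: t => [||i|c args IH] //=.
congr App; first by case: c.
apply: (@eq_from_nth _ (TT Phi)); rewrite ?size_map // => i lti.
by rewrite (nth_map (TT Phi)) ?IH.
Qed.

Lemma immediate_rename (Phi : signature) rho sigma (t : term Phi) :
  immediate (rename rho sigma t) = immediate t.
Proof. by case: t => [||i|[f|p|] args] //=; rewrite all_map; apply: eq_all => -[]. Qed.

Lemma term_sort_rename (Phi : signature) rho sigma (t : term Phi) :
  {in fvars t, forall p, fv_sort (rho p) = fv_sort p} ->
  term_sort (rename rho sigma t) = term_sort t.
Proof.
elim/term_nth_ind: t => [||i|[f|p|] args IH] //= Hrho.
  by rewrite Hrho ?mem_head.
case: args IH Hrho => [|a [|b [|d [|]]]] //= IH Hrho.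
by apply: (IH 1) => // x xb; apply: Hrho; rewrite !mem_cat /= xb orbT.
Qed.

(** * Paths in a term and the flattening of a single part *)

(** The empty path is defined even when [t] is immediate, because every part has its own root as a
    position. *)
Fixpoint subterm (Phi : signature) (t : term Phi) (pi : seq nat) : option (term Phi) :=
  if pi is i :: pi' then
    if t is App c args then
      if (i < size args) && ~~ immediate (nth (TT Phi) args i)
      then subterm (nth (TT Phi) args i) pi' else None
    else None
  else Some t.

Lemma subterm_rename (Phi : signature) rho sigma (t : term Phi) pi :
  subterm (rename rho sigma t) pi = omap (rename rho sigma) (subterm t pi).
Proof.
elim: pi t => [|i pi IH] [||x|c args] //=.
rewrite size_map; case: ltnP => //= lti.
by rewrite (nth_map (TT Phi)) // immediate_rename IH; case: ifP.
Qed.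

Lemma mem_ivars_subterm (Phi : signature) (t s : term Phi) pi :
  subterm t pi = Some s -> {subset ivars s <= ivars t}.
Proof.
elim: pi t => [t [->] //|i pi IH] [||x|c args] //=.
case: ltnP => //= lti; case: ifP => // _ /IH sub x xs.
exact/(@mem_ivars_nth _ c _ i)/sub.
Qed.

Lemma mem_fvars_subterm (Phi : signature) (t s : term Phi) pi :
  subterm t pi = Some s -> {subset fvars s <= fvars t}.
Proof.
elim: pi t => [t [->] //|i pi IH] [||x|c args] //=.
case: ltnP => //= lti; case: ifP => // _ /IH sub x xs.
exact/(@mem_fvars_nth _ c _ i)/sub.
Qed.

Lemma subterm_change (Phi : signature) (c : op Phi) l r g h i pi :
  i != size l ->
  subterm (App c (l ++ g :: r)) (i :: pi) = subterm (App c (l ++ h :: r)) (i :: pi).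
Proof. by move=> nil /=; rewrite (nth_change _ r g h) // !size_cat. Qed.

Lemma subterm_here (Phi : signature) (c : op Phi) l r g pi :
  subterm (App c (l ++ g :: r)) (size l :: pi) =
  if immediate g then None else subterm g pi.
Proof.
rewrite /= size_cat /= addnS ltnS leq_addr nth_middle.
by case: immediate.
Qed.

(** All arguments of an irreducible term are immediate: if the term is itself immediate, they are
    individual variables. *)
Lemma subterm_irreducible (Phi : signature) (t : term Phi) i pi :
  irreducible_term t -> subterm t (i :: pi) = None.
Proof.
case: t => [||x|c args] //= irr; case: ltnP => //= lti.
suff -> : immediate (nth (TT Phi) args i) by [].
case/orP: irr => [|/all_In]; last by apply; exact: In_nth.
case: c => // p /all_In /(_ _ (In_nth (TT Phi) lti)).
by case: nth.
Qed.

(* Only the arguments of [t] that are not immediate become calls; [kappa i] names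
   the part that receives the [i]-th argument. *)
Definition flat (Phi : signature) (rho : fvar -> fvar) (sigma : nat -> nat)
    (xs : seq nat) (kappa : nat -> fvar) (t : term Phi) : term Phi :=
  if t is App c args then
    App (if c is Ofun p then Ofun Phi (rho p) else c)
      (mkseq (fun i => if immediate (nth (TT Phi) args i)
                       then rename rho sigma (nth (TT Phi) args i)
                       else call Phi (kappa i) (map sigma xs)) (size args))
  else rename rho sigma t.

Lemma rename_call (Phi : signature) rho sigma q xs :
  rename rho sigma (call Phi q xs) = call Phi (rho q) (map sigma xs).
Proof. by rewrite /call /= -!map_comp. Qed.

Lemma immediate_call (Phi : signature) q xs : immediate (call Phi q xs).
Proof. by rewrite /= all_map; apply/allP. Qed.

(** Renaming after flattening serves to compare two flattenings of one program. Only nonimmediate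
    arguments become calls, so [kappa1] is constrained only there. *)
Lemma rename_flat (Phi : signature) rho1 rho2 rho sigma1 sigma2 sigma xs
    kappa1 kappa (t : term Phi) :
  {in fvars t, forall p, rho2 (rho1 p) = rho p} ->
  {in ivars t, forall x, sigma2 (sigma1 x) = sigma x} ->
  {in xs, forall x, sigma2 (sigma1 x) = sigma x} ->
  (forall i s, subterm t [:: i] = Some s -> rho2 (kappa1 i) = kappa i) ->
  rename rho2 sigma2 (flat rho1 sigma1 xs kappa1 t) = flat rho sigma xs kappa t.
Proof.
case: t => [||i|c args] //= Hrho Hsigma Hxs Hkappa.
  by rewrite Hsigma ?mem_head.
congr App; first by case: c Hrho => //= p -> //; rewrite mem_head.
apply: (@eq_from_nth _ (TT Phi)); rewrite ?size_map // => i; rewrite size_iota => lti.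
rewrite (nth_map (TT Phi)) ?size_mkseq // !nth_mkseq //.
case: ifP => imm.
  apply: rename_comp => x xi; first exact/Hrho/(@mem_fvars_nth _ c _ i).
  exact/Hsigma/(@mem_ivars_nth _ c _ i).
rewrite rename_call -map_comp (Hkappa i (nth (TT Phi) args i)) ?lti ?imm //.
by congr call; apply/eq_in_map.
Qed.

(** Renaming before flattening serves to pull a flattening back along a congruence. *)
Lemma flat_rename (Phi : signature) rho1 rho2 rho sigma1 sigma2 sigma xs
    kappa (t : term Phi) :
  (forall p, rho2 (rho1 p) = rho p) ->
  (forall x, sigma2 (sigma1 x) = sigma x) ->
  flat rho2 sigma2 (map sigma1 xs) kappa (rename rho1 sigma1 t)
  = flat rho sigma xs kappa t.
Proof.
case: t => [||i|c args] //= Hrho Hsigma; first by rewrite Hsigma.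
congr App; first by case: c => //= p; rewrite Hrho.
rewrite size_map; apply: (@eq_from_nth _ (TT Phi)); rewrite ?size_mkseq // => i lti.
rewrite !nth_mkseq // (nth_map (TT Phi)) // immediate_rename; case: ifP => _.
  by apply: rename_comp => x _.
by rewrite -map_comp; congr call; apply: eq_map.
Qed.

Lemma flat_irreducible (Phi : signature) xs kappa (t : term Phi) :
  irreducible_term t -> flat id id xs kappa t = t.
Proof.
case: t => [||i|c args] // irr; rewrite /flat.
congr App; first by case: c irr.
apply: (@eq_from_nth _ (TT Phi)); rewrite ?size_mkseq // => i lti.
rewrite nth_mkseq //; case: ifP => [_|/negbT imm]; first exact: rename_id.
(* A nonimmediate argument would give a path of length one. *)
by have := @subterm_irreducible _ _ i [::] irr; rewrite /= lti imm.
Qed.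

(** On the left [g] becomes a call of [kappa (size l)]; on the right the call of [q] is immediate
    and is merely renamed. The two agree once [q] is renamed to the name of the part for [g]. *)
Lemma flat_change (Phi : signature) rho sigma xs kappa kappa' (c : op Phi) l r g q :
  ~~ immediate g ->
  (forall i, i != size l -> kappa i = kappa' i) -> kappa (size l) = rho q ->
  flat rho sigma xs kappa (App c (l ++ g :: r)) =
  flat rho sigma xs kappa' (App c (l ++ call Phi q xs :: r)).
Proof.
move=> imm Hk Hq; rewrite /flat !size_cat /=; congr App.
apply: eq_mkseq => i; have [->|ni] := eqVneq i (size l).
  by rewrite !nth_middle (negbTE imm) immediate_call rename_call Hq.
by rewrite (nth_change _ r g (call Phi q xs)) // Hk.
Qed.

(** * Parts of a program and their keys *)

(* Parts are keyed by their function variable, and the head by [None]. *)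
Definition mkpart (Phi : signature) (k : option fvar) (xs : seq nat) (t : term Phi) :
    part Phi :=
  if k is Some p then BodyPart (Eqn p xs t) else HeadPart t xs.

Definition has_part (Phi : signature) (E : xprogram Phi) k xs t : Prop :=
  xset E (mkpart k xs t).

Lemma mkpart_inj (Phi : signature) k k' xs xs' (t t' : term Phi) :
  mkpart k xs t = mkpart k' xs' t' -> [/\ k = k', xs = xs' & t = t'].
Proof. by case: k k' => [p|] [p'|] // [] *; subst. Qed.

Lemma body_wf (Phi : signature) (E : program Phi) e :
  List.In e (prog_body E) -> wf_equation (bound_fvars E) e.
Proof. by move=> eE; case/and4P: (prog_wf E) => _ _ _ /all_In; apply. Qed.

Lemma uniq_bound_fvars (Phi : signature) (E : program Phi) : uniq (bound_fvars E).
Proof. by case/and4P: (prog_wf E). Qed.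

Lemma body_eqn_inj (Phi : signature) (E : program Phi) e e' :
  List.In e (prog_body E) -> List.In e' (prog_body E) ->
  eqn_fun e = eqn_fun e' -> e = e'.
Proof. exact/uniq_map_In_inj/uniq_bound_fvars. Qed.

Lemma has_part_inj (Phi : signature) (E : xprogram Phi) k xs xs' t t' :
  has_part E k xs t -> has_part E k xs' t' -> xs = xs' /\ t = t'.
Proof.
case: k => [p|] /=; last by move=> [-> ->] [-> ->].
by move=> H H'; have [] := body_eqn_inj H H' erefl.
Qed.

Lemma has_part_vars (Phi : signature) (E : xprogram Phi) k xs t :
  has_part E k xs t -> uniq xs /\ {subset ivars t <= xs}.
Proof.
case: k => [p|] /=.
  by case/body_wf/and5P=> /= _ ? /allP ? _ _.
by move=> [-> ->]; case/andP: (xprog_wf E) => ? /allP.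
Qed.

Lemma has_part_fvars (Phi : signature) (E : xprogram Phi) k xs t :
  has_part E k xs t -> {subset fvars t <= bound_fvars E}.
Proof.
case: k => [p|] /=; first by case/body_wf/and5P=> /= _ _ _ _ /andP[_ /allP].
by move=> [-> _]; case/and4P: (prog_wf E) => _ _ /allP.
Qed.

Lemma has_part_bound (Phi : signature) (E : xprogram Phi) p xs t :
  has_part E (Some p) xs t -> p \in bound_fvars E.
Proof. exact: In_map_mem. Qed.

Lemma bound_has_part (Phi : signature) (E : xprogram Phi) p :
  p \in bound_fvars E -> exists xs t, has_part E (Some p) xs t.
Proof. by case/mem_map_In=> -[p' xs t] Hp <-; exists xs, t. Qed.

Lemma has_part_arity (Phi : signature) (E : xprogram Phi) p xs t :
  has_part E (Some p) xs t -> fv_arity p = size xs.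
Proof. by case/body_wf/and5P=> /= /eqP. Qed.

Lemma has_part_sort (Phi : signature) (E : xprogram Phi) p xs t :
  has_part E (Some p) xs t -> term_sort t = fv_sort p.
Proof. by case/body_wf/and5P=> /= _ _ _ _ /andP[/eqP]. Qed.

Lemma irreducible_has_part (Phi : signature) (E : xprogram Phi) k xs t :
  irreducible E -> has_part E k xs t -> irreducible_term t.
Proof.
case/andP=> h0 /all_In h; case: k => [p|] /=; first by move/h.
by move=> [-> _].
Qed.

(** * A criterion for congruence *)

(** No permutation has to be exhibited: the function variables of a body are distinct, so a
    correspondence of equations in both directions forces one. *)
Lemma congruentI (Phi : signature) (E F : program Phi) (rho : fvar -> fvar) :
  {in bound_fvars E &, injective rho} ->
  {in bound_fvars E, forall p,
     fv_sort (rho p) = fv_sort p /\ fv_arity (rho p) = fv_arity p} ->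
  prog_head F = rename rho id (prog_head E) ->
  (forall e, List.In e (prog_body E) ->
     exists2 f, List.In f (prog_body F) & alpha_equation rho e f) ->
  (forall f, List.In f (prog_body F) ->
     exists2 e, List.In e (prog_body E) & rho (eqn_fun e) = eqn_fun f) ->
  congruent E F.
Proof.
move=> rho_inj rho_sort headE EF FE.
(* One image is chosen for each equation; the names in [b] are the [rho]-images of those of [E],
   hence distinct. *)
have [b [bF Eb bE]] : exists b, [/\ forall f, List.In f b -> List.In f (prog_body F),
    List.Forall2 (alpha_equation rho) (prog_body E) b &
    map (@eqn_fun Phi) b = map rho (bound_fvars E)].
  rewrite /bound_fvars; elim: (prog_body E) EF => [|e s IH] EF.
    by exists [::]; split => //; constructor.
  have [|b [bF Eb bE]] := IH; first by move=> e' e's; apply: EF; right.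
  have [f fF ef] := EF e (or_introl erefl).
  exists (f :: b); split => /=; [by move=> g [<-//|/bF]|by constructor|].
  by rewrite bE; case: ef => sigma _ ->.
exists rho, b; split => //; apply: NoDup_Permutation.
- by apply: (@uniq_map_NoDup _ _ (@eqn_fun Phi)); rewrite bE map_inj_in_uniq ?uniq_bound_fvars.
- exact/uniq_map_NoDup/uniq_bound_fvars.
move=> f; split; first exact: bF.
move=> fF; have [e eE ef] := FE f fF.
have /mem_map_In[f' f'b f'e] : eqn_fun f \in map (@eqn_fun Phi) b.
  by rewrite bE -ef; apply/map_f/In_map_mem.
by rewrite (body_eqn_inj fF (bF _ f'b)).
Qed.

(** * Flattenings and their uniqueness *)

Definition is_position (Phi : signature) (E : xprogram Phi)
    (k : option fvar) (pi : seq nat) : Prop :=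
  exists xs t s, has_part E k xs t /\ subterm t pi = Some s.

(** Only the root of the head yields a nameless part, the head of the flattening, so the value [nu
    None [::]] is never consulted. *)
Definition position_key (nu : option fvar -> seq nat -> fvar) k pi : option fvar :=
  if (k == None) && (pi == [::]) then None else Some (nu k pi).

Lemma is_position_bound (Phi : signature) (E : xprogram Phi) p :
  p \in bound_fvars E -> is_position E (Some p) [::].
Proof. by case/bound_has_part=> xs [t H]; exists xs, t, t. Qed.

(* The part of [F] for the position [pi] of part [k] has its own renaming [sigma],
   since congruence renames the variables of each equation separately. *)
Definition flattening (Phi : signature) (E F : xprogram Phi) : Prop :=
  exists nu : option fvar -> seq nat -> fvar,
  [/\ forall k pi k' pi', is_position E k pi -> is_position E k' pi' ->
        position_key nu k pi = position_key nu k' pi' -> k = k' /\ pi = pi',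
      forall q, q \in bound_fvars F ->
        exists k pi, is_position E k pi /\ position_key nu k pi = Some q,
      forall k xs t pi s q, has_part E k xs t -> subterm t pi = Some s ->
        position_key nu k pi = Some q -> fv_sort q = term_sort s
    & forall k xs t pi s, has_part E k xs t -> subterm t pi = Some s ->
        exists sigma, [/\ {in xs &, injective sigma},
          position_key nu k pi = None -> sigma = id
        & has_part F (position_key nu k pi) (map sigma xs)
            (flat (fun p => nu (Some p) [::]) sigma xs
               (fun i => nu k (rcons pi i)) s)]].

(** Only the empty path exists in an irreducible term, so each part is its own single position. *)
Lemma flattening_refl (Phi : signature) (E : xprogram Phi) :
  irreducible E -> flattening E E.
Proof.
(* A position is named by its key; the default [Fvar Ind 0 0] stands in for the head, whose root has
   no name. *)
move=> irr; pose nu (k : option fvar) (pi : seq nat) := odflt (Fvar Ind 0 0) k.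
have pos k xs t pi s : has_part E k xs t -> subterm t pi = Some s -> pi = [::] /\ s = t.
  move=> Ht; case: pi => [[<-] //|i pi].
  by rewrite subterm_irreducible //; exact: irreducible_has_part Ht.
have key k : position_key nu k [::] = k by case: k.
exists nu; split.
- move=> k pi k' pi' [xs [t [s [H /(pos _ _ _ _ _ H)[-> _]]]]].
  move=> [xs' [t' [s' [H' /(pos _ _ _ _ _ H')[-> _]]]]].
  by rewrite !key.
- by move=> q /is_position_bound qE; exists (Some q), [::].
- move=> k xs t pi s q H /(pos _ _ _ _ _ H)[-> ->]; rewrite key => Hk.
  by rewrite Hk in H; rewrite (has_part_sort H).
move=> k xs t pi s H /(pos _ _ _ _ _ H)[-> ->]; rewrite key.
exists id; split => //; rewrite map_id.
by rewrite (_ : flat _ _ _ _ t = t) //; exact/flat_irreducible/(irreducible_has_part irr H).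
Qed.

Lemma flattening_xvars (Phi : signature) (E F : xprogram Phi) :
  flattening E F -> xvars F = xvars E.
Proof.
case=> nu [_ _ _ /(_ None (xvars E) (prog_head E) [::] _ (conj erefl erefl) erefl)].
by case=> sigma [_ /(_ erefl) -> [_ <-]]; rewrite map_id.
Qed.

(** The naming [nu] is composed with the renaming of function variables, and each [sigma] with the
    renaming belonging to the equation at hand. *)
Lemma flattening_congruent (Phi : signature) (E E' F : xprogram Phi) :
  xcongruent E E' -> flattening E' F -> flattening E F.
Proof.
move=> [xE [rho0 [b [rho0_inj rho0_sort hE Eb bE]]]] [nu [nu_inj nu_surj nu_sort nu_part]].
have toE' k xs t : has_part E k xs t -> exists sigma0, [/\ {in xs &, injective sigma0},
    k = None -> sigma0 = id &
    has_part E' (omap rho0 k) (map sigma0 xs) (rename rho0 sigma0 t)].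
  case: k => [p|] /=; last first.
    by move=> [-> ->]; exists id; split => //; rewrite /has_part /= map_id hE xE.
  move=> Hp; have {}Hp : List.In (Eqn p xs t) (prog_body E) := Hp.
  suff [e' e'b [sigma0 si e'E]] :
      exists2 e', List.In e' b & alpha_equation rho0 (Eqn p xs t) e'.
    exists sigma0; split => //; apply: Permutation_in bE _.
    by move: e'b; rewrite e'E.
  elim: Eb Hp => [[]|e e' s s' ee' _ IH] [<-|/IH[f fs ef]].
    by exists e' => //; left.
  by exists f => //; right.
have fromE' k' xs' t' : has_part E' k' xs' t' -> exists k xs t, has_part E k xs t /\ k' = omap rho0 k.
  case: k' => [p'|] /=; last by move=> _; exists None, (xvars E), (prog_head E).
  move=> /(Permutation_in _ (Permutation_sym bE)) Hp'.
  suff [e eE [sigma0 _ [-> _ _]]] :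
      exists2 e, List.In e (prog_body E) & alpha_equation rho0 e (Eqn p' xs' t').
    by exists (Some (eqn_fun e)), (eqn_vars e), (eqn_rhs e); case: e eE.
  elim: Eb Hp' => [[]|e e' s s' ee' _ IH] [e'E|/IH[f fs ef]].
    by exists e; [left|rewrite -e'E].
  by exists f => //; right.
have key k pi : position_key (fun k => nu (omap rho0 k)) k pi = position_key nu (omap rho0 k) pi.
  by case: k.
have pos k pi : is_position E k pi -> is_position E' (omap rho0 k) pi.
  move=> [xs [t [s [H ts]]]]; have [sigma0 [_ _ H']] := toE' _ _ _ H.
  exists (map sigma0 xs), (rename rho0 sigma0 t), (rename rho0 sigma0 s); split => //.
  by rewrite subterm_rename ts.
(* [rho0] is injective on bound variables only, so both keys have to come from parts of [E]. *)
have omap_inj k k' pi pi' : is_position E k pi -> is_position E k' pi' ->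
    omap rho0 k = omap rho0 k' -> k = k'.
  move=> [xs [t [_ [H _]]]] [xs' [t' [_ [H' _]]]].
  case: k k' H H' => [p|] [p'|] //= /has_part_bound Hp /has_part_bound Hp' [].
  by move/(rho0_inj _ _ Hp Hp') ->.
exists (fun k => nu (omap rho0 k)); split.
- move=> k pi k' pi' Hk Hk'; rewrite !key => eqk.
  have [ek ->] := nu_inj _ _ _ _ (pos _ _ Hk) (pos _ _ Hk') eqk.
  by split=> //; exact: omap_inj Hk Hk' ek.
- move=> q /nu_surj[k' [pi [[xs' [t' [s' [H' ts']]]] kq]]].
  have [k [xs [t [H ek]]]] := fromE' _ _ _ H'.
  exists k, pi; rewrite key -ek; split => //; exists xs, t.
  have [sigma0 [_ _ ]] := toE' _ _ _ H; rewrite -ek => H2.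
  have [_ et] := has_part_inj H' H2.
  by move: ts'; rewrite et subterm_rename; case: subterm => // s _; exists s.
- move=> k xs t pi s q H ts; rewrite key => kq.
  have [sigma0 [_ _ H']] := toE' _ _ _ H.
  rewrite (nu_sort _ _ _ pi (rename rho0 sigma0 s) q H') ?subterm_rename ?ts //.
  apply: term_sort_rename => p ps.
  by have [] := rho0_sort p (has_part_fvars H (mem_fvars_subterm ts ps)).
move=> k xs t pi s H ts; rewrite key.
have [sigma0 [si sid H']] := toE' _ _ _ H.
have [|sigma [sinj sigid HF]] := nu_part _ _ _ pi (rename rho0 sigma0 s) H'.
  by rewrite subterm_rename ts.
exists (sigma \o sigma0); split.
- move=> x y xxs yxs /= /sinj; rewrite !map_f // => /(_ erefl erefl).
  exact: si.
- move=> keyN; rewrite sigid // sid //.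
  by case: (k) keyN.
rewrite map_comp; congr has_part: HF.
exact: flat_rename.
Qed.

Lemma position_key_rcons nu k pi i :
  position_key nu k (rcons pi i) = Some (nu k (rcons pi i)).
Proof. by rewrite /position_key; case: pi => [|j pi] /=; rewrite andbF. Qed.

Lemma subterm_rcons (Phi : signature) (t s s' : term Phi) pi i :
  subterm t pi = Some s -> subterm s [:: i] = Some s' ->
  subterm t (rcons pi i) = Some s'.
Proof.
move=> + ss'; elim: pi t => [|j pi IH] t; first by case=> ->.
by case: t => // c args; rewrite rcons_cons [LHS]/=; case: ifP => //= -> /IH.
Qed.

(** The lists [map sigma1 xs] and [map sigma2 xs] will be the parameters of corresponding equations
    in two flattenings; [tau] is [sigma2] after the inverse of [sigma1]. *)
Lemma transport_inj (sigma1 sigma2 : nat -> nat) (xs : seq nat) :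
  {in xs &, injective sigma1} -> {in xs &, injective sigma2} ->
  exists2 tau : nat -> nat, {in map sigma1 xs &, injective tau} &
    {in xs, forall x, tau (sigma1 x) = sigma2 x}.
Proof.
move=> inj1 inj2.
(* Searching the list inverts [sigma1]: by injectivity on [xs] the entry found is the preimage of
   [y]. The default [0] concerns only [y] outside the image. *)
pose tau y := sigma2 (nth 0 xs (index y (map sigma1 xs))).
have tauE : {in xs, forall x, tau (sigma1 x) = sigma2 x}.
  move=> x xxs; rewrite /tau; set i := index _ _.
  have lti : i < size xs by rewrite -(size_map sigma1) index_mem map_f.
  congr sigma2; apply: inj1; rewrite ?mem_nth //.
  by rewrite -(nth_map 0 (sigma1 0)) // nth_index ?map_f.
exists tau => // _ _ /mapP[x xxs ->] /mapP[y yxs ->].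
by rewrite !tauE // => /inj2 ->.
Qed.

Lemma flattening_unique (Phi : signature) (E F F' : xprogram Phi) :
  flattening E F -> flattening E F' -> xcongruent F F'.
Proof.
move=> flF flF'; split; first by rewrite (flattening_xvars flF) (flattening_xvars flF').
move: flF flF' => [nu [nu_inj nu_surj nu_sort nu_part]] [nu' [nu'_inj nu'_surj nu'_sort nu'_part]].
(* Whether a key is [None] depends on [k] and [pi] alone, so both namings single out the same
   position as head. *)
have keyN k pi q : position_key nu k pi = Some q -> position_key nu' k pi = Some (nu' k pi).
  by rewrite /position_key; case: ifP.
have keyN' k pi q : position_key nu' k pi = Some q -> position_key nu k pi = Some (nu k pi).
  by rewrite /position_key; case: ifP.
(* The name of a position under [nu] is sent to its name under [nu']. Injectivity of [nu] on
   positions makes this well defined; other variables may go anywhere. *)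
have [rho rhoE] : exists rho : fvar -> fvar, forall k pi q, is_position E k pi ->
    position_key nu k pi = Some q -> rho q = nu' k pi.
  have /choice[rho rhoP] : forall q, exists q', forall k pi, is_position E k pi ->
      position_key nu k pi = Some q -> q' = nu' k pi.
    move=> q; have [[k [pi [Hk kq]]]|none] :=
      EM (exists k pi, is_position E k pi /\ position_key nu k pi = Some q).
      exists (nu' k pi) => k' pi' Hk' k'q.
      by have [|-> ->] := nu_inj k pi k' pi' Hk Hk'; rewrite ?kq.
    by exists q => k pi Hk kq; case: none; exists k, pi.
  by exists rho => k pi q; apply: rhoP.
(* Every function variable in a flattened part, whether an old one renamed or that of a new call, is
   the name of a position, so [rho] acts correctly on it. *)
have flatE k xs t pi s sigma sigma' tau : has_part E k xs t -> subterm t pi = Some s ->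
    {in xs, forall x, tau (sigma x) = sigma' x} ->
    rename rho tau (flat (fun p => nu (Some p) [::]) sigma xs (fun i => nu k (rcons pi i)) s)
    = flat (fun p => nu' (Some p) [::]) sigma' xs (fun i => nu' k (rcons pi i)) s.
  move=> H ts tauE; apply: rename_flat => //.
  - move=> p ps; apply: rhoE => //; apply: is_position_bound.
    exact/(has_part_fvars H)/(mem_fvars_subterm ts).
  - move=> x xsx; apply: tauE; have [_] := has_part_vars H; apply.
    exact: (mem_ivars_subterm ts).
  move=> i s' ss'; apply: rhoE; last exact: position_key_rcons.
  exists xs, t, s'; split => //; exact: subterm_rcons ts ss'.
have sortE k xs t pi s q : has_part E k xs t -> subterm t pi = Some s ->
    position_key nu k pi = Some q -> fv_sort (nu' k pi) = fv_sort q.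
  move=> H ts kq; rewrite (nu_sort _ _ _ _ _ _ H ts kq).
  exact: (nu'_sort _ _ _ _ _ _ H ts (keyN _ _ _ kq)).
have sourceF q : q \in bound_fvars F -> exists k xs t pi s,
    [/\ has_part E k xs t, subterm t pi = Some s & position_key nu k pi = Some q].
  by move=> /nu_surj[k [pi [[xs [t [s [H ts]]]] kq]]]; exists k, xs, t, pi, s.
apply: (@congruentI _ F F' rho).
- move=> q1 q2 /nu_surj[k1 [pi1 [H1 e1]]] /nu_surj[k2 [pi2 [H2 e2]]].
  rewrite (rhoE _ _ _ H1 e1) (rhoE _ _ _ H2 e2) => e12.
  have [|ek epi] := nu'_inj _ _ _ _ H1 H2.
    by rewrite (keyN _ _ _ e1) (keyN _ _ _ e2) e12.
  by move: e2; rewrite -ek -epi e1 => -[].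
(* Both names carry the sort of the subterm at the position; their arities agree because both
   parameter lists are renamings of the same [xs]. *)
- move=> q /sourceF[k [xs [t [pi [s [H ts kq]]]]]].
  have Hk : is_position E k pi by exists xs, t, s.
  rewrite (rhoE _ _ _ Hk kq); split; first exact: sortE H ts kq.
  have [sigma [_ _ ]] := nu_part _ _ _ _ _ H ts; rewrite kq => /has_part_arity ->.
  have [sigma' [_ _ ]] := nu'_part _ _ _ _ _ H ts.
  by rewrite (keyN _ _ _ kq) => /has_part_arity ->; rewrite !size_map.
(* At the head both individual renamings are the identity, as congruence requires. *)
- have H : has_part E None (xvars E) (prog_head E) by [].
  have [sigma [_ sid [<- _]]] := nu_part _ _ _ [::] _ H erefl.
  have [sigma' [_ sid' [<- _]]] := nu'_part _ _ _ [::] _ H erefl.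
  by rewrite (flatE _ _ _ [::] _ _ sigma' _ H) // sid // sid'.
- move=> e eF; have [k [xs [t [pi [s [H ts kq]]]]]] := sourceF _ (In_map_mem _ eF).
  have Hk : is_position E k pi by exists xs, t, s.
  have [sigma [inj1 _ ]] := nu_part _ _ _ _ _ H ts; rewrite kq => HF.
  have [sigma' [inj2 _ ]] := nu'_part _ _ _ _ _ H ts.
  rewrite (keyN _ _ _ kq) => HF'.
  rewrite -(body_eqn_inj HF eF erefl) /=.
  have [tau inj3 tauE] := transport_inj inj1 inj2.
  eexists; first exact: HF'.
  exists tau => //; rewrite /rename_equation /= (rhoE _ _ _ Hk kq) (flatE _ _ _ _ _ _ _ _ H ts tauE).
  by congr Eqn; rewrite -map_comp; apply/esym/eq_in_map.
move=> f fF'; have [k [pi [Hk kq]]] := nu'_surj _ (In_map_mem _ fF').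
have [xs [t [s [H ts]]]] := Hk.
have [sigma [_ _ ]] := nu_part _ _ _ _ _ H ts.
rewrite (keyN' _ _ _ kq) => HF; eexists; first exact: HF.
rewrite /= (rhoE _ _ _ Hk (keyN' _ _ _ kq)).
by move: kq; rewrite /position_key; case: ifP => // _ [].
Qed.

(** * Flattenings pulled back along one-step reduction *)

(* Body and head reductions at once: [k] is the key of the reduced part. *)
Definition split_part (Phi : signature) (E E' : xprogram Phi) k xs c l g r q : Prop :=
  [/\ has_part E k xs (App c (l ++ g :: r)), ~~ immediate g, fresh E q,
      fv_sort q = term_sort g
    & xset E' = (xset E `\ mkpart k xs (App c (l ++ g :: r)) `|`
         [set mkpart k xs (App c (l ++ call Phi q xs :: r));
              mkpart (Some q) xs g])%classic].

Lemma red1_split_part (Phi : signature) (E E' : xprogram Phi) :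
  red1 E E' -> exists k xs c l g r q, split_part E E' k xs c l g r q.
Proof.
move=> [p [j [q [xs c l g r H _ ig fq _ sq EE'|c l g r _ fq H _ ig _ sq EE']]]].
  by exists (Some p), xs, c, l, g, r, q.
by exists None, (xvars E), c, l, g, r, q; split => //; rewrite -H.
Qed.

Lemma term_sort_change (Phi : signature) (c : op Phi) l g h r :
  term_sort g = term_sort h ->
  term_sort (App c (l ++ g :: r)) = term_sort (App c (l ++ h :: r)).
Proof.
(* Only a conditional reads its sort off an argument, whence the cases on the place of the replaced
   one. *)
by case: c => //= gh; case: l => [|a [|b [|d [|e l]]]] //=;
  case: r => [|x [|y [|z r]]].
Qed.

Lemma flattening_red1 (Phi : signature) (E E' F : xprogram Phi) :
  red1 E E' -> flattening E' F -> flattening E F.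
Proof.
move=> /red1_split_part[k0 [xs0 [c [l [g [r [q [H0 ig fq sq EE']]]]]]]].
have Hk0 : has_part E' k0 xs0 (App c (l ++ call Phi q xs0 :: r)).
  by rewrite /has_part EE'; right; left.
have Hq : has_part E' (Some q) xs0 g by rewrite /has_part EE'; right; right.
have HEE' k xs t : has_part E k xs t -> k <> k0 -> has_part E' k xs t.
  by move=> H nk; rewrite /has_part EE'; left; split => // /mkpart_inj[].
have HE'E k xs t : has_part E' k xs t -> k <> k0 -> k <> Some q -> has_part E k xs t.
  by rewrite {1}/has_part EE' => -[[]//|[|] /mkpart_inj[]].
have Eq k xs t : has_part E k xs t -> k <> Some q.
  by move=> + kq; rewrite kq => /has_part_bound; exact/negP.
have qk0 : k0 <> Some q by exact: Eq H0.
move=> [nu' [nu_inj nu_surj nu_sort nu_part]].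
(* A position is moved when its path enters the extracted argument; [mk] and [mpi] give its part and
   its path in [E']. *)
pose moved (k : option fvar) (pi : seq nat) := (k == k0) && (ohead pi == Some (size l)).
pose mk k pi := if moved k pi then Some q else k.
pose mpi k pi := if moved k pi then behead pi else pi.
pose nu k pi := nu' (mk k pi) (mpi k pi).
have nu_moved pi : nu k0 (size l :: pi) = nu' (Some q) pi.
  by rewrite /nu /mk /mpi /moved !eqxx.
have nu_stay k pi : ~~ moved k pi -> nu k pi = nu' k pi.
  by rewrite /nu /mk /mpi => /negbTE ->.
have movedP k pi : moved k pi -> k = k0 /\ exists pi', pi = size l :: pi'.
  by case/andP=> /eqP -> /eqP; case: pi => //= _ pi [->]; split => //; exists pi.
have key k pi : position_key nu k pi = position_key nu' (mk k pi) (mpi k pi).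
  rewrite /position_key /nu /mk /mpi; have [m|//] := boolP (moved k pi).
  by have [_ [pi' ->]] := movedP _ _ m; rewrite andbF.
(* the part of [E'] in which a position of [E] lives *)
have trace k xs t pi s : has_part E k xs t -> subterm t pi = Some s ->
    exists t' s', [/\ has_part E' (mk k pi) xs t', subterm t' (mpi k pi) = Some s',
      term_sort s' = term_sort s
    & forall sigma, flat (fun p => nu (Some p) [::]) sigma xs (fun i => nu k (rcons pi i)) s
        = flat (fun p => nu' (Some p) [::]) sigma xs
            (fun i => nu' (mk k pi) (rcons (mpi k pi) i)) s'].
  (* Empty paths are never moved, so the old function variables keep their names. *)
  have nu0 : (fun p => nu (Some p) [::]) = (fun p => nu' (Some p) [::]).
    by apply: boolp.funext => p; apply: nu_stay; rewrite /moved andbF.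
  have [m|nm] := boolP (moved k pi).
    have [ek [pi' epi]] := movedP _ _ m; subst k pi => H ts.
    have [exs et] := has_part_inj H0 H; subst xs t.
    move: ts; rewrite subterm_here (negbTE ig) /mk /mpi m /= => ts.
    exists g, s; split => // sigma; rewrite nu0.
    by congr (flat _ _ _ _ _); apply: boolp.funext => i; exact: nu_moved.
  move=> H ts; rewrite /mk /mpi (negbTE nm).
  have [ek|nk] := eqVneq k k0; last first.
    exists t, s; split => //; first by apply: HEE' => //; apply/eqP.
    move=> sigma; rewrite nu0; congr (flat _ _ _ _ _); apply: boolp.funext => i.
    by apply: nu_stay; rewrite /moved (negbTE nk).
  subst k; have [exs et] := has_part_inj H0 H; subst xs t.
  exists (App c (l ++ call Phi q xs0 :: r)).
  (* At the root of [k0] the term itself changes and [flat_change] compares the two versions; a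
     nonempty path that is not moved avoids the extracted argument. *)
  case: pi nm ts => [_ [<-]|i pi nm ts].
    exists (App c (l ++ call Phi q xs0 :: r)); split => //.
      exact: term_sort_change.
    move=> sigma; rewrite nu0; apply: flat_change => //; last exact: nu_moved.
    by move=> i ni; apply: nu_stay; rewrite /moved eqxx.
  have ni : i != size l by move: nm; rewrite /moved eqxx.
  exists s; split => //; first by rewrite -ts; apply: subterm_change.
  move=> sigma; rewrite nu0; congr (flat _ _ _ _ _); apply: boolp.funext => j.
  by apply: nu_stay; rewrite /moved eqxx.
have pos k pi : is_position E k pi -> is_position E' (mk k pi) (mpi k pi).
  move=> [xs [t [s [H ts]]]]; have [t' [s' [H' ts' _ _]]] := trace _ _ _ _ _ H ts.
  by exists xs, t', s'.
exists nu; split.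
(* Moved positions land in [q], which is no part of [E], so they cannot collide with the others. *)
- move=> k pi k' pi' Hk Hk'; rewrite !key => eqk.
  have [] := nu_inj _ _ _ _ (pos _ _ Hk) (pos _ _ Hk') eqk.
  move: Hk Hk' => [? [? [? [/Eq kq _]]]] [? [? [? [/Eq k'q _]]]].
  rewrite /mk /mpi; case: ifP => [/movedP[-> [pi1 ->]]|_];
    case: ifP => [/movedP[-> [pi2 ->]]|_] //=; first by move=> _ ->.
  by move=> /esym.
- move=> p /nu_surj[k' [pi' [[xs [t [s [H ts]]]] kp]]].
  (* Backwards, a path in [q] gets [size l] in front, while a path in [k0] cannot enter the
     immediate call of [q] and stays as it is. *)
  have [ek|nk] := eqVneq k' (Some q).
    subst k'; have [exs et] := has_part_inj Hq H; subst xs t.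
    exists k0, (size l :: pi'); split; last by rewrite key /mk /mpi /moved !eqxx.
    by exists xs0, (App c (l ++ g :: r)), s; rewrite subterm_here (negbTE ig).
  have [ek|nk0] := eqVneq k' k0; last first.
    exists k', pi'; split; last by rewrite key /mk /mpi /moved (negbTE nk0).
    by exists xs, t, s; split => //; apply: HE'E => //; apply/eqP.
  subst k'; have [exs et] := has_part_inj Hk0 H; subst xs t.
  have nm : ~~ moved k0 pi'.
    apply/negP => /movedP[_ [pi2 epi]]; move: ts.
    by rewrite epi subterm_here immediate_call.
  exists k0, pi'; split; last by rewrite key /mk /mpi (negbTE nm).
  exists xs0, (App c (l ++ g :: r)); case: pi' nm ts {kp} => [|i pi'] nm ts.
    by exists (App c (l ++ g :: r)).
  exists s; split => //; rewrite -ts; apply: subterm_change.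
  by move: nm; rewrite /moved eqxx.
- move=> k xs t pi s p H ts; rewrite key => kp.
  have [t' [s' [H' ts' <- _]]] := trace _ _ _ _ _ H ts.
  exact: nu_sort H' ts' kp.
move=> k xs t pi s H ts; have [t' [s' [H' ts' _ fl]]] := trace _ _ _ _ _ H ts.
have [sigma [si sid HF]] := nu_part _ _ _ _ _ H' ts'.
by exists sigma; split => //; rewrite key // fl.
Qed.

(** * Existence of irreducible reducts *)

Lemma split_not_all (T : Type) (P : pred T) (s : seq T) :
  ~~ all P s -> exists l x r, s = l ++ x :: r /\ ~~ P x.
Proof.
elim: s => [|a s IH] //=; rewrite negb_and => /orP[Pa|/IH[l [x [r [-> Px]]]]].
  by exists [::], a, s.
by exists (a :: l), x, r.
Qed.

Lemma In_cat (T : Type) (x : T) (s1 s2 : seq T) :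
  List.In x (s1 ++ s2) <-> List.In x s1 \/ List.In x s2.
Proof. by elim: s1 => [|a s IH] /=; [|rewrite IH]; tauto. Qed.

(** This counts the nonempty paths on which [subterm] is defined. *)
Fixpoint weight (Phi : signature) (t : term Phi) : nat :=
  if t is App _ args then
    sumn (map (fun a => if immediate a then 0 else (weight a).+1) args)
  else 0.

Definition program_weight (Phi : signature) (E : program Phi) : nat :=
  weight (prog_head E) + sumn (map (fun e => weight (eqn_rhs e)) (prog_body E)).

(** The position of [g] itself is the one lost; those below it make up [weight g], which the new
    equation takes over. *)
Lemma weight_change (Phi : signature) (c : op Phi) l g h r :
  ~~ immediate g -> immediate h ->
  weight (App c (l ++ g :: r)) = (weight (App c (l ++ h :: r)) + weight g).+1.
Proof.
by move=> /negbTE ig ih; rewrite /= !map_cat !sumn_cat /= ig ih; lia.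
Qed.

Lemma wf_term_arg (Phi : signature) (c : op Phi) l g r :
  wf_term (App c (l ++ g :: r)) -> wf_term g.
Proof. by case/andP; rewrite all_cat => /and3P[]. Qed.

Lemma wf_term_change (Phi : signature) (c : op Phi) l g h r :
  wf_term h -> term_sort h = term_sort g ->
  wf_term (App c (l ++ g :: r)) -> wf_term (App c (l ++ h :: r)).
Proof.
move=> wh hg /=; rewrite !all_cat /= wh.
case/andP=> /and3P[-> _ ->] /=; case: c => [f|p|]; rewrite ?all_cat /= ?size_cat /= ?hg //.
by case: l => [|a [|b [|d [|e l]]]]; case: r => [|x [|y [|z r]]]; rewrite //= ?hg.
Qed.

Lemma all_ivars_change (Phi : signature) (P : pred nat) (c : op Phi) l g h r :
  all P (ivars h) -> all P (ivars (App c (l ++ g :: r))) ->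
  all P (ivars (App c (l ++ h :: r))).
Proof. by rewrite /= !map_cat !flatten_cat !all_cat => -> /and3P[-> _ ->]. Qed.

Lemma all_ivars_arg (Phi : signature) (P : pred nat) (c : op Phi) l g r :
  all P (ivars (App c (l ++ g :: r))) -> all P (ivars g).
Proof. by rewrite /= map_cat flatten_cat !all_cat => /and3P[]. Qed.

Lemma all_fvars_change (Phi : signature) (P : pred fvar) (c : op Phi) l g h r :
  all P (fvars h) -> all P (fvars (App c (l ++ g :: r))) ->
  all P (fvars (App c (l ++ h :: r))).
Proof.
by rewrite /= !map_cat !flatten_cat !all_cat => -> /and4P[-> -> _ ->].
Qed.

Lemma all_fvars_arg (Phi : signature) (P : pred fvar) (c : op Phi) l g r :
  all P (fvars (App c (l ++ g :: r))) -> all P (fvars g).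
Proof. by rewrite /= map_cat flatten_cat !all_cat => /and4P[]. Qed.

Lemma ivars_call (Phi : signature) q xs : ivars (call Phi q xs) = xs.
Proof. by rewrite /= -map_comp; elim: xs => //= x xs ->. Qed.

Lemma fvars_call (Phi : signature) q xs : fvars (call Phi q xs) = [:: q].
Proof. by rewrite /= -map_comp; elim: xs. Qed.

Lemma wf_call (Phi : signature) q xs :
  fv_arity q = size xs -> wf_term (call Phi q xs).
Proof. by move=> aq; rewrite /= size_map aq eqxx !all_map; apply/andP; split; apply/allP. Qed.

Lemma all_mem_cons (T : eqType) (x : T) (ps s : seq T) :
  all (mem ps) s -> all (mem (x :: ps)) s.
Proof. by apply: sub_all => y /= yps; rewrite inE yps orbT. Qed.

Lemma wf_equation_cons (Phi : signature) q ps (e : equation Phi) :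
  wf_equation ps e -> wf_equation (q :: ps) e.
Proof.
case/and5P=> h1 h2 h3 h4 /andP[h5 h6].
by apply/and5P; split => //; rewrite h5 all_mem_cons.
Qed.

Lemma step_body_exists (Phi : signature) (E : xprogram Phi) p xs c l g r :
  has_part E (Some p) xs (App c (l ++ g :: r)) -> ~~ immediate g ->
  exists2 E', red1 E E' & program_weight E' < program_weight E.
Proof.
set t := App c _; set e := Eqn p xs t => Ht ig.
have [b1 [b2 bE]] : exists b1 b2, prog_body E = b1 ++ e :: b2.
  have {}Ht : List.In e (prog_body E) := Ht.
  elim: (prog_body E) Ht => [[]|a s IH] [->|/IH[b1 [b2 ->]]].
    by exists [::], s.
  by exists (a :: b1), b2.
set q := fresh_fvar (bound_fvars E) (term_sort g) (size xs).
have fq : q \notin bound_fvars E by exact: fresh_fvarP.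
set t' := App c (l ++ call Phi q xs :: r).
(* The new equation may be put first, since a step compares programs as sets of parts. *)
pose b := Eqn q xs g :: b1 ++ Eqn p xs t' :: b2.
have bfE : bound_fvars E = map (@eqn_fun Phi) (b1 ++ Eqn p xs t' :: b2).
  by rewrite /bound_fvars bE !map_cat.
have wfb : wf_program (prog_head E) b.
  have /and4P[uE wh fh] := prog_wf E; rewrite -/(bound_fvars E).
  rewrite /wf_program /b [map _ (_ :: _)]/= -bfE /= fq uniq_bound_fvars wh.
  rewrite bE !all_cat /= => /and3P[w1 we w2].
  rewrite all_mem_cons //= !(sub_all (@wf_equation_cons _ q _)) //= !andbT.
  case/and5P: we => /= h1 h2 h3 h4 /andP[/eqP h5 h6].
  apply/andP; split; apply/and5P; split => //=.
  - exact: all_ivars_arg h3.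
  - exact: wf_term_arg h4.
  - by rewrite eqxx all_mem_cons // (all_fvars_arg h6).
  - by apply: (@all_ivars_change _ _ c l g (call Phi q xs) r) h3; rewrite ivars_call; apply/allP.
  - by apply: (@wf_term_change _ c l g (call Phi q xs) r) h4 => //; exact: wf_call.
  apply/andP; split; first by rewrite -h5; apply/eqP/term_sort_change.
  apply: (@all_fvars_change _ _ c l g (call Phi q xs) r) (all_mem_cons _ h6).
  by rewrite fvars_call /= mem_head.
have wfx : uniq (xvars E) && all (mem (xvars E)) (ivars (prog_head (Program wfb))).
  exact: xprog_wf E.
exists (XProgram wfx); last first.
  pose w (f : equation Phi) := weight (eqn_rhs f).
  rewrite /program_weight -/w bE ltn_add2l -/b.
  have -> : sumn (map w b) = weight g + sumn (map w (b1 ++ Eqn p xs t' :: b2)) by [].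
  rewrite !map_cat !sumn_cat.
  have -> : sumn (map w (e :: b2)) = weight t + sumn (map w b2) by [].
  have -> : sumn (map w (Eqn p xs t' :: b2)) = weight t' + sumn (map w b2) by [].
  by rewrite (weight_change c l r ig (immediate_call Phi q xs)) -/t'; lia.
exists p, (size l).+1, q; apply: (@step_body _ _ _ _ _ _ xs c l g r) => //.
  by rewrite (has_part_arity Ht).
(* Names in a body are distinct, so [e] occurs once and removing it from the set leaves all of [b1]
   and [b2]. *)
have neq f : List.In f b1 \/ List.In f b2 -> f <> e.
  have := uniq_bound_fvars E; rewrite /bound_fvars bE map_cat cat_uniq /=.
  rewrite negb_or => /and4P[_ /andP[/negP e1 _] /negP e2 _] [] /(In_map_mem (@eqn_fun Phi)) fb fe.
    by apply: e1; move: fb; rewrite fe.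
  by apply: e2; move: fb; rewrite fe.
have eE f : List.In f (prog_body E) <-> List.In f b1 \/ f = e \/ List.In f b2.
  by rewrite bE In_cat /=; intuition.
have eE' f : List.In f b <-> f = Eqn q xs g \/ List.In f b1 \/ f = Eqn p xs t' \/ List.In f b2.
  by rewrite /b /= In_cat /=; intuition.
apply/seteqP; split => -[s ys|f].
- by move=> H; left.
- move=> /eE' [->|[fb|[->|fb]]]; [by right; right| |by right; left|];
    by left; split; [apply/eE; tauto|move=> [] /neq; apply; tauto].
- by case=> [[]|[]].
case=> [[/eE fE fe]|[|] [->]]; apply/eE'; [|tauto|tauto].
have {}fe : f <> e by move=> ef; apply: fe; rewrite ef.
tauto.
Qed.

Lemma step_head_exists (Phi : signature) (E : xprogram Phi) c l g r :
  prog_head E = App c (l ++ g :: r) -> ~~ immediate g ->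
  exists2 E', red1 E E' & program_weight E' < program_weight E.
Proof.
set t := App c _ => hE ig.
set q := fresh_fvar (bound_fvars E) (term_sort g) (size (xvars E)).
have fq : q \notin bound_fvars E by exact: fresh_fvarP.
set t' := App c (l ++ call Phi q (xvars E) :: r).
pose b := Eqn q (xvars E) g :: prog_body E.
have /andP[ux vx] := xprog_wf E.
have wfb : wf_program t' b.
  have /and4P[uE] := prog_wf E; rewrite -/(bound_fvars E) hE => wh fh wE.
  rewrite /wf_program /b [map _ (_ :: _)]/= -/(bound_fvars E).
  apply/and4P; split; first by rewrite /= fq.
  - by apply: (@wf_term_change _ c l g (call Phi q (xvars E)) r) wh => //; exact: wf_call.
  - apply: (@all_fvars_change _ _ c l g (call Phi q (xvars E)) r) (all_mem_cons _ fh).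
    by rewrite fvars_call /= mem_head.
  apply/andP; split; last exact: sub_all (@wf_equation_cons _ q _) _ wE.
  apply/and5P; split => //=; first by move: vx; rewrite hE; exact: all_ivars_arg.
    exact: wf_term_arg wh.
  by rewrite eqxx all_mem_cons // (all_fvars_arg fh).
have wfx : uniq (xvars E) && all (mem (xvars E)) (ivars (prog_head (Program wfb))).
  rewrite ux; apply: (@all_ivars_change _ _ c l g (call Phi q (xvars E)) r).
    by rewrite ivars_call; apply/allP.
  by move: vx; rewrite hE.
exists (XProgram wfx); last first.
  pose w (f : equation Phi) := weight (eqn_rhs f).
  rewrite /program_weight -/w hE.
  have -> : sumn (map w b) = weight g + sumn (map w (prog_body E)) by [].
  have -> : weight (prog_head (Program wfb)) = weight t' by [].
  by rewrite (weight_change c l r ig (immediate_call Phi q (xvars E))) -/t'; lia.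
(* The label [p] of a head step is only asked to be fresh; [Ind] and [0] are arbitrary. *)
exists (fresh_fvar (bound_fvars E) Ind 0), (size l).+1, q.
apply: (@step_head _ _ _ _ _ _ c l g r) => //; first exact: fresh_fvarP.
apply/seteqP; split => -[s ys|f].
- by case=> -> ->; right; left.
- by case=> [<-|fE]; [right; right|left; split].
- case=> [[[-> ->] []]|[[-> ->]|//]]; last by [].
  by rewrite hE.
by case=> [[fE _]|[//|[->]]]; [right|left].
Qed.

Lemma reducible_term (Phi : signature) (t : term Phi) :
  ~~ irreducible_term t ->
  exists c l g r, t = App c (l ++ g :: r) /\ ~~ immediate g.
Proof.
case: t => [||x|c args] //; rewrite negb_or => /andP[_ /split_not_all].
by move=> [l [g [r [-> ig]]]]; exists c, l, g, r.
Qed.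

Lemma irreducible_or_red1 (Phi : signature) (E : xprogram Phi) :
  irreducible E \/ exists2 E', red1 E E' & program_weight E' < program_weight E.
Proof.
have [hi|/reducible_term[c [l [g [r [hE ig]]]]]] := boolP (irreducible_term (prog_head E));
  last by right; exact: step_head_exists hE ig.
have [bi|/split_not_all[b1 [[p xs t] [b2 [bE]]]]] :=
  boolP (all (fun e => irreducible_term (eqn_rhs e)) (prog_body E)).
  by left; apply/andP.
move=> /reducible_term[c [l [g [r [/= et ig]]]]]; right.
apply: (@step_body_exists _ E p xs c l g r) => //.
by rewrite -et /has_part /= bE; apply/In_cat; right; left.
Qed.

Lemma xcongruent_refl (Phi : signature) (E : xprogram Phi) : xcongruent E E.
Proof.
split=> //; apply: (@congruentI _ E E id) => //; first by rewrite rename_id.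
  move=> e eE; exists e => //; exists id => //.
  by case: e {eE} => p xs t; rewrite /rename_equation /= map_id rename_id.
by move=> e eE; exists e.
Qed.

Lemma reduces_trans_red1 (Phi : signature) (E E' F : xprogram Phi) :
  red1 E E' -> reduces E' F -> reduces E F.
Proof.
move=> EE' [E'F|[G E'G GF]]; right; first by exists E' => //; apply: t_step.
by exists G => //; apply: t_trans E'G; apply: t_step.
Qed.

Lemma reduces_irreducible (Phi : signature) (E : xprogram Phi) :
  exists F : xprogram Phi, irreducible F /\ reduces E F.
Proof.
(* Strong induction on the weight, which drops along a suitable step from any program that is not
   irreducible. *)
have [n] := ubnP (program_weight E); elim: n E => // n IH E En.
have [irr|[E' EE' lt]] := irreducible_or_red1 E.
  by exists E; split => //; left; exact: xcongruent_refl.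
have [|F [irr E'F]] := IH E'; first by lia.
by exists F; split => //; exact: reduces_trans_red1 EE' E'F.
Qed.

(** * The canonical form *)

(** The flattening is pulled back through the final congruence and then through the steps, from last
    to first. *)
Lemma flattening_reduces (Phi : signature) (E E' F : xprogram Phi) :
  reduces E E' -> flattening E' F -> flattening E F.
Proof.
move=> [EE'|[G EG GE']] flF; first exact: flattening_congruent flF.
have {flF GE'} := flattening_congruent GE' flF.
by elim: EG => [? ? /flattening_red1|? ? ? _ IH1 _ IH2 /IH2/IH1]; apply.
Qed.

Theorem theorem4p5 (Phi : signature) :
  exists cf : xprogram Phi -> xprogram Phi,
    (forall E : xprogram Phi,
       [/\ xvars (cf E) = xvars E,
           irreducible (cf E),
           reduces E (cf E)
         & forall F : xprogram Phi,
             irreducible F -> reduces E F -> xcongruent F (cf E)]) /\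
    (forall E F : xprogram Phi,
       reduces E F -> xcongruent (cf E) (cf F)).
Proof.
have [cf cfP] := choice (@reduces_irreducible Phi).
(* [cf E] is irreducible, so it flattens itself, and this is pulled back along the reduction from
   [E]. *)
have flat_cf E : flattening E (cf E).
  by have [irr red] := cfP E; apply: flattening_reduces red (flattening_refl irr).
exists cf; split=> [E|E F EF]; last first.
  (* [cf F] flattens [F], hence also [E], where it meets [cf E]. *)
  exact: flattening_unique (flat_cf E) (flattening_reduces EF (flat_cf F)).
have [irr red] := cfP E; split => //; first exact: flattening_xvars.
move=> F irrF EF; apply: flattening_unique (flat_cf E).
exact: flattening_reduces EF (flattening_refl irrF).
Qed.
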